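(* Let $n\ge 1$, let $K_n$ be the complete graph on the vertices $v_1,\dots,v_n$, and let $g$ be a proper vertex coloring of $K_n$ by positive integers (so $g(v_1),\dots,g(v_n)$ are pairwise distinct positive integers). Then $g$ is a graceful coloring of $K_n$ if and only if the set $\{g(v_i) : 1\le i\le n\}$ is $3$-AP-free.
   Context: For a positive integer $l$, write $[1,l]=\{1,2,\dots,l\}$. A graceful coloring of a simple graph $G$ is a proper vertex coloring $g:V(G)\to[1,l]$, for some integer $l\ge 2$ (adjacent vertices receive distinct values), such that the induced edge coloring $g^*:E(G)\to[1,l-1]$, $g^*(ab)=|g(a)-g(b)|$ for each edge $ab$, is a proper edge coloring (any two distinct edges sharing an endpoint receive distinct values). A set (or sequence) of integers is $3$-AP-free if it contains no three distinct terms $a,b,c$ with $|b-a|=|c-b|$, i.e. no three-term arithmetic progression. *)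

(* Defs.v *)
From mathcomp Require Import all_boot all_order all_algebra.

Set Implicit Arguments.
Unset Strict Implicit.
Unset Printing Implicit Defensive.

Record sgraph := SGraph {
  vertex :> finType;
  adj : rel vertex;
  adj_sym : symmetric adj;
  adj_irrefl : irreflexive adj
}.

Definition edges (G : sgraph) : {set {set G}} :=
  [set [set p.1; p.2] | p in [set p : G * G | adj p.1 p.2]].

Definition complete_adj n : rel 'I_n := fun i j => i != j.

Lemma complete_adj_sym n : symmetric (@complete_adj n).
Proof. by move=> i j; rewrite /complete_adj eq_sym. Qed.

Lemma complete_adj_irrefl n : irreflexive (@complete_adj n).
Proof. by move=> i; rewrite /complete_adj eqxx. Qed.

(* The vertices are indexed by 0, ..., n - 1 instead of 1, ..., n. *)
Definition complete_graph n : sgraph :=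
  SGraph (@complete_adj_sym n) (@complete_adj_irrefl n).

Definition proper_vertex_coloring (G : sgraph) (g : G -> nat) : Prop :=
  forall a b : G, adj a b -> g a <> g b.

Definition proper_edge_coloring (G : sgraph) (h : {set G} -> nat) : Prop :=
  forall e f : {set G}, e \in edges G -> f \in edges G ->
    e <> f -> (exists v : G, v \in e /\ v \in f) -> h e <> h f.

(* An edge is an unordered pair, so |g a - g b| is written symmetrically as the
   largest difference of colors within the edge; see induced_edge_coloringE. *)
Definition induced_edge_coloring (G : sgraph) (g : G -> nat) (e : {set G}) :
    nat :=
  \max_(a in e) \max_(b in e) `|g a - g b|%N.

Lemma induced_edge_coloringE (G : sgraph) (g : G -> nat) (a b : G) :
  induced_edge_coloring g [set a; b] = `|g a - g b|%N.
Proof.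
apply/eqP; rewrite eqn_leq; apply/andP; split.
  apply/bigmax_leqP=> x; rewrite !inE => /orP[]/eqP->;
  apply/bigmax_leqP=> y; rewrite !inE => /orP[]/eqP->;
  by rewrite ?distnn // distnC.
have aP : a \in [set a; b] by rewrite !inE eqxx.
have bP : b \in [set a; b] by rewrite !inE eqxx orbT.
apply: leq_trans (leq_bigmax_cond _ aP).
exact: (leq_bigmax_cond (F := fun y => `|g a - g y|%N) _ bP).
Qed.

Definition graceful_coloring (G : sgraph) (g : G -> nat) : Prop :=
  exists l : nat,
    [/\ 2 <= l,
        forall v : G, 1 <= g v <= l,
        proper_vertex_coloring g,
        forall e : {set G}, e \in edges G ->
          1 <= induced_edge_coloring g e <= l.-1
      & proper_edge_coloring (induced_edge_coloring g)].

(* The three terms are distinct values, so repetitions in s play no role and s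
   stands for the set of its terms. *)
Definition ap3_free (s : seq int) : Prop :=
  forall a b c : int, a \in s -> b \in s -> c \in s ->
    a <> b -> b <> c -> a <> c -> (`|b - a| <> `|c - b|)%R.

(* Main.v *)
Require Import Defs.
From mathcomp Require Import all_boot all_order all_algebra.
From mathcomp Require Import zify.

(** Two distinct edges meeting at [v] have distinct other ends [a], [b], and their labels agree
    exactly when [g v] is equidistant from the distinct colors [g a] and [g b], that is, when it is
    the middle of a 3-AP. In a complete graph every 3-AP of colors arises so. The range conditions
    only ask for a large enough [l]. *)

Lemma edges_pair (G : sgraph) (a b : G) : adj a b -> [set a; b] \in edges G.
Proof. by move=> ab; apply/imsetP; exists (a, b); rewrite ?inE. Qed.

(** Normalises edges at a common vertex, so that they differ only in their other end. *)
Lemma edges_incident (G : sgraph) (e : {set G}) (v : G) :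
  e \in edges G -> v \in e -> exists2 u, adj u v & e = [set u; v].
Proof.
case/imsetP=> -[a b]; rewrite inE /= => ab ->; rewrite !inE => /orP[]/eqP ->.
  by exists b; [rewrite adj_sym | rewrite setUC].
by exists a.
Qed.

Theorem theorem2p4 (n : nat) (n_ge1 : 1 <= n)
    (g : complete_graph n -> nat) (g_pos : forall v : complete_graph n, 1 <= g v)
    (g_proper : proper_vertex_coloring g) :
  graceful_coloring g <-> ap3_free [seq Posz (g v) | v : complete_graph n].
Proof.
split=> [[l [_ _ _ _ edge_proper]] | free].
  move=> _ _ _ /imageP[x _ ->] /imageP[y _ ->] /imageP[z _ ->] xy yz xz dist_eq.
  have neq (u v : complete_graph n) : Posz (g u) <> Posz (g v) -> u != v.
    by move=> guv; apply/eqP=> uv; apply: guv; rewrite uv.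
  have exy : [set x; y] \in edges (complete_graph n).
    by apply: edges_pair; apply: neq.
  have ezy : [set z; y] \in edges (complete_graph n).
    by apply: edges_pair; apply: neq => zy; apply: yz.
  (* The edges from the middle term [y] to [x] and [z] would share a label. *)
  case: (edge_proper _ _ exy ezy).
  - move/setP/(_ x); rewrite !inE eqxx /=.
    by rewrite (negbTE (neq _ _ xy)) (negbTE (neq _ _ xz)).
  - by exists y; rewrite !inE eqxx !orbT.
  - by rewrite !induced_edge_coloringE; lia.
have [m g_max] : exists m, forall v, g v <= m.
  by exists (\max_v g v) => v; apply: leq_bigmax.
(* [m.+2] is at least 2 whatever [m] is, and differences of colors stay below it. *)
exists m.+2.
split=> // [v | _ /imsetP[[a b] + ->] | e f eE fE ef [v [ve vf]]].
- by rewrite g_pos; move: (g_max v); lia.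
- rewrite inE /= => ab; rewrite induced_edge_coloringE.
  by have := g_proper _ _ ab; have := g_max a; have := g_max b; lia.
have [a av ea] := edges_incident _ _ _ eE ve.
have [b bv fb] := edges_incident _ _ _ fE vf.
(* Completeness enters here: distinct other ends are adjacent, so [g_proper] separates their
   colors. *)
have ab : adj a b by apply/eqP=> ab; apply: ef; rewrite ea fb ab.
have := g_proper _ _ av; have := g_proper _ _ bv; have := g_proper _ _ ab.
move=> gab gbv gav; rewrite ea fb !induced_edge_coloringE => h_eq.
have mem u : Posz (g u) \in [seq Posz (g v) | v : complete_graph n].
  exact: image_f.
by apply: (free _ _ _ (mem a) (mem v) (mem b)); lia.
Qed.
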